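(* Let $\phi\in H^1_{\mathrm{per}}(0,1)$ with $\|\phi'\|_{L^2(0,1)}>0$, and let $a,b$ be real numbers with $b>1$ and $0<a<1<ab$. For $N\ge0$ let $W_N(x)=\sum_{n=0}^{N}a^n\phi(b^nx)$, with weak derivative $W_N'(x)=\sum_{n=0}^N(ab)^n\phi'(b^nx)$, and define $$\zeta_N=\left[\frac1{b^N}\int_0^{b^N}|\phi'(u)|^2\,du\right]^{1/2}.$$ Then for every $N\ge1$ $$\|W_N'-W_{N-1}'\|_{L^2(0,1)}=(ab)^N\zeta_N,$$ and $\zeta_N\to\|\phi'\|_{L^2(0,1)}$ as $N\to\infty$. Consequently $$\|W_N'-W_{N-1}'\|_{L^2(0,1)}\sim(ab)^N\|\phi'\|_{L^2(0,1)}\qquad(N\to\infty),$$ so the adjacent increments diverge and the sequence $\{W_N'\}_{N\ge0}$ is not Cauchy in $L^2(0,1)$. If $b\in\mathbb N$ and $b\ge2$, then $\zeta_N=\|\phi'\|_{L^2(0,1)}$ for every $N$.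
   Context: $H^1_{\mathrm{per}}(0,1)$ denotes the one-periodic functions on $\mathbb R$ that are locally in $H^1$; $\phi'$ is the (one-periodic) weak derivative. $A_N\sim B_N$ means $A_N/B_N\to1$. *)

(* Defs.v *)
From HB Require Import structures.
From mathcomp Require Import all_boot all_order all_algebra.
From mathcomp Require Import all_classical all_reals all_analysis.

Set Implicit Arguments.
Unset Strict Implicit.
Unset Printing Implicit Defensive.

Import Order.TTheory GRing.Theory Num.Theory.
Import numFieldNormedType.Exports.

Local Open Scope classical_set_scope.
Local Open Scope ring_scope.

(* Elements of the function spaces are represented by Borel functions R -> R;
   the measure is Lebesgue measure throughout. *)

Section FunctionSpaces.
Context {R : realType}.
Implicit Types f g psi : R -> R.

Notation mu := (@lebesgue_measure R).

(* C_c^infinity(R) *)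
Definition test_function psi : Prop :=
  (forall (n : nat) (x : R), derivable (derive1n n psi) x 1) /\
  compact (closure [set x : R | psi x != 0]).

Definition is_weak_derivative f g : Prop :=
  [/\ locally_integrable [set: R] f,
      locally_integrable [set: R] g &
      forall psi, test_function psi ->
        \int[mu]_x (f x * derive1 psi x) = - \int[mu]_x (g x * psi x)].

Definition L2_loc f : Prop :=
  measurable_fun [set: R] f /\
  forall K : set R, compact K -> (\int[mu]_(x in K) (`|f x| ^+ 2)%:E < +oo)%E.

Definition H1_loc f : Prop :=
  L2_loc f /\ exists g, is_weak_derivative f g /\ L2_loc g.

Definition H1_per f : Prop := periodic f 1 /\ H1_loc f.

(* L^2(0,1) is realised inside L^2(R): f \_ D is f on D and 0 elsewhere. *)
Definition on_unit f : R -> R := f \_ `]0, 1[.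

Definition L2_unit f : Prop := on_unit f \in Lfun mu 2%:E.

(* This is the L^2(0,1) norm when L2_unit f holds; otherwise [fine] may turn
   +oo into 0. *)
Definition L2norm f : R :=
  fine ('N[mu]_2%:E[EFin \o on_unit f])%E.

Definition L2_cauchy (F : nat -> R -> R) : Prop :=
  forall e : R, 0 < e -> exists M : nat, forall m n : nat,
    (M <= m)%N -> (M <= n)%N -> L2norm (F m \- F n) < e.

End FunctionSpaces.

Definition asymp_equiv {R : realType} (A B : nat -> R) : Prop :=
  A N / B N @[N --> \oo] --> (1 : R).

Section Weierstrass.
Context {R : realType}.
Variables (a b : R).

Definition W (phi : R -> R) (N : nat) (x : R) : R :=
  \sum_(0 <= n < N.+1) a ^+ n * phi (b ^+ n * x).

Definition dW (dphi : R -> R) (N : nat) (x : R) : R :=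
  \sum_(0 <= n < N.+1) (a * b) ^+ n * dphi (b ^+ n * x).

Definition zeta (dphi : R -> R) (N : nat) : R :=
  Num.sqrt ((b ^+ N)^-1 *
    \int[@lebesgue_measure R]_(u in `[0, b ^+ N]) (`|dphi u| ^+ 2)).

End Weierstrass.

(* Main.v *)
Require Import Defs.
From HB Require Import structures.
From mathcomp Require Import all_boot all_order all_algebra.
From mathcomp Require Import all_classical all_reals all_analysis.
From mathcomp Require Import measurable_realfun.
From mathcomp Require Import ring lra.

Import Order.TTheory GRing.Theory Num.Theory.
Import numFieldNormedType.Exports.

Local Open Scope classical_set_scope.
Local Open Scope ring_scope.

Set Implicit Arguments.
Unset Strict Implicit.
Unset Printing Implicit Defensive.

(** The [N]-th increment of the derivatives is a single dilated term,
[(a b)^N dphi(b^N x)], and the substitution [u = b^N x] turns its norm on (0,1)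
into [(a b)^N] times the root mean square [zeta_N] of [dphi] over [[0, b^N]]
([L2norm_increment]).  Since [|dphi|^2] is one-periodic and nonnegative, its
integral over [[0, t]] differs from [t] times its integral over one period by
at most the latter ([Rintegral_itv_mean]); dividing by [t = b^N], which tends
to infinity, gives [zeta_N --> ||dphi||], with equality when [b^N] is an integer.
As [a b > 1] and [||dphi|| > 0], the increments diverge, which is incompatible
with the Cauchy property.

The work lies in the word [weak].  The weak derivative [dphi] is only given by
its pairing with test functions, so its periodicity and its local square
integrability have to be extracted from that pairing.  Both follow from
uniqueness of weak derivatives up to null sets ([weak_derivative_unique]): the
translate [dphi(x + 1)] is a weak derivative of the translate of [phi], which is
[phi]; and [phi], being locally in H^1, has some locally square integrable weak
derivative.

Uniqueness is the fundamental lemma of the calculus of variations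
([ae_eq0_test]).  If [h] is orthogonal to all test functions, its integral over
every bounded open interval vanishes, because the indicator of the interval is
a bounded pointwise limit of test functions ([cvg_plateau]); Lebesgue's
differentiation theorem then gives [h = 0] almost everywhere.  The
approximating functions are explicit products of two rescaled copies of
[exp(-1/x)], so that no convolution is involved. *)

(** * Affine substitutions in Lebesgue integrals *)

Section AffineSubstitution.
Context {R : realType}.
Implicit Types (c d : R) (A D : set R).
Notation mu := (@lebesgue_measure R).

(** The type annotations put Borel sets on both sides, so that the push-forward
of [lebesgue_measure] by [affine c d] is a measure of the same kind. *)
Definition affine c d (x : measurableTypeR R) : measurableTypeR R := c * x + d.

Lemma measurable_affine c d :
  measurable_fun [set: measurableTypeR R] (affine c d).
Proof. by apply: measurable_funD => //; exact: mulrl_measurable. Qed.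

Lemma affine_preimage_itv c d (b1 b2 : bool) (u v : R) : 0 < c ->
  affine c d @^-1` [set` Interval (BSide b1 u) (BSide b2 v)] =
  [set` Interval (BSide b1 ((u - d) / c)) (BSide b2 ((v - d) / c))].
Proof.
move=> c0; apply/funext => x /=; rewrite /affine !in_itv/=; apply: congr1.
by congr (_ && _); [case: b1|case: b2] => /=;
  rewrite ?(ler_pdivrMr, ltr_pdivrMr, ler_pdivlMr, ltr_pdivlMr)//
    ?(lerBlDr, ltrBlDr, lerBrDr, ltrBrDr) (mulrC x).
Qed.

(** Both sides are measures in [A], so by uniqueness of Lebesgue measure it is
enough to compare them on intervals [`]u, v]]. *)
Lemma lebesgue_measure_affine c d A : 0 < c -> measurable A ->
  pushforward mu (affine c d) A = (c^-1%:E * mu A)%E.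
Proof.
move=> c0 mA; have ma := measurable_affine c d.
suff -> : mu A = (c%:E * pushforward mu (affine c d) A)%E.
  by rewrite muleA -EFinM mulVf ?mul1e ?gt_eqF.
(* The measure structure of a push-forward takes the measurability proof as an
   argument that unification cannot find, so it is given by name. *)
pose nu := mscale (NngNum (ltW c0))
  (measure_function_pushforward__canonical__measure_function_Measure mu ma).
rewrite -[RHS]/(nu A).
apply: lebesgue_measure_unique mA => _ [[u v]] _ <-.
rewrite -[RHS]/(c%:E * mu (affine c d @^-1` [set` `]u, v]]))%E.
rewrite affine_preimage_itv// !lebesgue_measure_itv/= !lte_fin.
rewrite ltr_pM2r ?invr_gt0// ltrD2r; case: ifPn => _; last by rewrite mule0.
by rewrite -!EFinB -EFinM; congr EFin; field; rewrite gt_eqF.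
Qed.

Lemma ge0_integral_affine c d D (f : R -> \bar R) : 0 < c ->
  measurable D -> measurable_fun D f -> (forall x, D x -> 0 <= f x)%E ->
  (\int[mu]_(x in affine c d @^-1` D) f (c * x + d)%R =
   c^-1%:E * \int[mu]_(x in D) f x)%E.
Proof.
move=> c0 mD mf f0; have ma := measurable_affine c d.
rewrite -[LHS](@ge0_integral_pushforward _ _ _ _ _ (affine c d))//; last first.
  by move=> x /set_mem; exact: f0.
have ci0 : 0 <= c^-1 by rewrite invr_ge0 ltW.
rewrite -(@ge0_integral_mscale _ _ _ mu _ mD (NngNum ci0))//.
by apply: eq_measure_integral => A mA _; exact: lebesgue_measure_affine.
Qed.

Lemma integrable_affine c d (f : R -> R) : 0 < c ->
  mu.-integrable [set: R] (EFin \o f) ->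
  mu.-integrable [set: R] (fun x => (f (c * x + d))%:E).
Proof.
move=> c0 /integrableP[mf fi]; apply/integrableP; split.
  by apply: (measurableT_comp mf); exact: measurable_affine.
have := @ge0_integral_affine c d setT (fun x => `|(f x)%:E|%E) c0 measurableT.
rewrite preimage_setT => -> //; last exact: measurableT_comp.
by apply: lte_mul_pinfty => //; rewrite lee_fin invr_ge0 ltW.
Qed.

Lemma Rintegral_affine c d (f : R -> R) : 0 < c ->
  mu.-integrable [set: R] (EFin \o f) ->
  \int[mu]_x f (c * x + d) = c^-1 * \int[mu]_x f x.
Proof.
move=> c0 intf; have /integrableP[mf _] := intf.
have intcf := integrable_affine d c0 intf.
rewrite /Rintegral.
rewrite -[c^-1]/(fine c^-1%:E) -fineM//; last exact: integrable_fin_num.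
congr fine; rewrite integralE [in RHS]integralE.
rewrite muleBr//; last first.
  by apply: fin_num_adde_defr; exact: integrable_pos_fin_num.
have P := @ge0_integral_affine c d setT _ c0 measurableT.
rewrite preimage_setT in P.
rewrite -(P _ (measurable_funepos mf))// -(P _ (measurable_funeneg mf))//.
by congr (_ - _)%E; apply: eq_integral => x _; rewrite ?funeposE ?funenegE.
Qed.

End AffineSubstitution.

(** * Smooth functions and test functions *)

Section SmoothFunctions.
Context {R : realType}.
Implicit Types (f g psi : R -> R) (c d x : R) (k n : nat).

Definition smooth f := forall n x, derivable (derive1n n f) x 1.

(** Coinductive principle for smoothness: exhibiting a class of differentiable
functions stable under derivation avoids computing iterated derivatives. *)
Lemma smooth_class (S : set (R -> R)) :
  (forall f, S f -> (forall x, derivable f x 1) /\ S (derive1 f)) ->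
  forall f, S f -> smooth f.
Proof.
move=> SD f Sf n x; suff /SD[] : S (derive1n n f) by [].
elim: n => [//|n IHn]; rewrite derive1nS.
by have [] := SD _ IHn.
Qed.

(** The exponent [k] makes the family stable under derivation up to linear
combinations, see [is_derive_flat]; [flat 0] is the classical smooth function
that is flat at the origin. *)
Definition flat k x : R := if 0 < x then x^-1 ^+ k * expR (- x^-1) else 0.

(** A single term of the exponential series at [1 / x], the one of degree
[k + 2], already dominates; the two spare powers of [x] are what makes [flat k]
differentiable at the origin with derivative zero. *)
Lemma flat_le k x : `|flat k x| <= k.+2`!%:R * x ^+ 2.
Proof.
rewrite /flat; case: ifPn => [x0|_]; last by rewrite normr0 mulr_ge0 ?sqr_ge0.
have u0 : 0 < x^-1 by rewrite invr_gt0.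
rewrite ger0_norm; last by rewrite mulr_ge0 ?expR_ge0 ?exprn_ge0 ?(ltW u0).
rewrite expRN ler_pdivrMr ?expR_gt0//.
have := @expR_ge1Dxn R x^-1 k.+1 (ltW u0).
move=> /(le_trans _) h.
have {h} : x^-1 ^+ k.+2 / k.+2`!%:R <= expR x^-1 by apply: h; rewrite lerDr.
rewrite ler_pdivrMr ?ltr0n ?fact_gt0// => h.
apply: (@le_trans _ _ (x ^+ 2 * x^-1 ^+ k.+2)).
  rewrite -(addn2 k) exprD mulrCA -exprMn mulfV ?gt_eqF// expr1n mulr1//.
rewrite [leRHS]mulrAC [leRHS]mulrC ler_pM2l ?exprn_gt0//.
by rewrite mulrC.
Qed.

Lemma is_derive_flat k x :
  is_derive x 1 (flat k) (- k%:R * flat k.+1 x + flat k.+2 x).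
Proof.
have [x0|x0|->] := ltgtP x 0.
- rewrite /flat !ifF ?mulr0 ?addr0//; do ?by apply/negbTE; rewrite -leNgt ltW.
  apply: (@near_eq_is_derive _ _ _ (cst 0)) => //.
  near=> y; rewrite /= ifF//; apply/negbTE; rewrite -leNgt ltW//.
  by near: y; exact: lt_nbhsl.
- apply: (@near_eq_is_derive R R^o R^o
    (fun y : R => y^-1 ^+ k * expR (- y^-1))).
    near=> y; rewrite /flat ifT//.
    by near: y; exact: lt_nbhsr.
  have V : is_derive x 1 (fun y : R => y^-1) (- x^-2).
    have := @is_deriveV R id x 1 1; rewrite [_ *: 1]mulr1.
    by apply; rewrite gt_eqF.
  have E : is_derive x 1 (fun y : R => expR (- y^-1)) (expR (- x^-1) * x^-2).
    apply: (@is_derive1_comp _ expR (fun y => - y^-1)).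
    by have := is_deriveN V; rewrite opprK.
  have X : is_derive x 1 (fun y : R => y^-1 ^+ k) (- k%:R * x^-1 ^+ k.+1).
    rewrite (_ : (fun _ => _) = (fun y : R => y^-1) ^+ k); last first.
      by rewrite exprfctE.
    apply: is_derive_eq (is_deriveX k V) _.
    case: k => [|k]; first by rewrite !mul0r scale0r oppr0 mul0r.
    rewrite /= -exprVn.
    change ((k.+1%:R * x^-1 ^+ k) * - x^-1 ^+ 2 = - k.+1%:R * x^-1 ^+ k.+2).
    by rewrite -(addn2 k) exprD; ring.
  apply: is_derive_eq (is_deriveM X E) _.
  rewrite -exprVn /flat x0; change (x^-1 ^+ k * (expR (- x^-1) * x^-1 ^+ 2)
    + expR (- x^-1) * (- k%:R * x^-1 ^+ k.+1) =
    - k%:R * (x^-1 ^+ k.+1 * expR (- x^-1)) + x^-1 ^+ k.+2 * expR (- x^-1)).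
  by rewrite !exprS; ring.
- have cv : h^-1 *: (flat k (h *: 1 + 0) - flat k 0) @[h --> 0^'] --> (0 : R).
    apply/norm_cvg0P.
    apply: (@squeeze_cvgr _ _ _ _ (cst 0) (fun h => k.+2`!%:R * `|h|)).
    - near=> h; rewrite normr_ge0/=.
      have h0 : h != 0 by near: h; exact: nbhs_dnbhs_neq.
      rewrite /flat ltxx subr0 -/(flat k _) [_ *: 1]mulr1 addr0 normrM normfV.
      rewrite ler_pdivrMl ?normr_gt0// mulrCA -expr2 real_normK ?num_real//.
      exact: flat_le.
    - exact: cvg_cst.
    - rewrite -[X in _ --> X](mulr0 k.+2`!%:R) -[in X in _ --> X](@normr0 _ R).
      apply: cvgMr; apply: cvg_norm; exact: nbhs_dnbhs.
  apply: DeriveDef.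
    by apply/cvg_ex; exists 0.
  rewrite /flat ltxx mulr0 addr0.
  exact: cvg_lim cv.
Unshelve. all: by end_near. Qed.

(** Closed under derivation by [is_derive_flat] and the Leibniz rule, and large
enough to contain the plateaus below; this is the class given to
[smooth_class]. *)
Inductive flat_algebra : (R -> R) -> Prop :=
| flat_algebra_affine k c d : flat_algebra (fun x => flat k (c * x + d))
| flat_algebraZ c f : flat_algebra f -> flat_algebra (fun x => c * f x)
| flat_algebraD f g : flat_algebra f -> flat_algebra g ->
    flat_algebra (fun x => f x + g x)
| flat_algebraM f g : flat_algebra f -> flat_algebra g ->
    flat_algebra (fun x => f x * g x).

Lemma is_derive_affine c d x : is_derive x 1 (fun x => c * x + d) c.
Proof.
have /= := is_deriveD (is_deriveZ c (is_derive_id x 1)) (is_derive_cst d x 1).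
by rewrite addr0 [_ *: 1]mulr1.
Qed.

Lemma is_derive_comp_affine f c d x a : is_derive (c * x + d) 1 f a ->
  is_derive x 1 (fun x => f (c * x + d)) (c * a).
Proof.
move=> fa; rewrite mulrC.
exact: (@is_derive1_comp _ f (fun x => c * x + d) x a c fa
  (is_derive_affine c d x)).
Qed.

Lemma is_derive1_fun f g : (forall x, is_derive x 1 f (g x)) ->
  (forall x, derivable f x 1) /\ derive1 f = g.
Proof.
move=> fg; split=> [x|]; first by case: (fg x).
by apply/funext => x; rewrite derive1E; apply: derive_val.
Qed.

Lemma smooth_flat_algebra f : flat_algebra f -> smooth f.
Proof.
apply: smooth_class => {}f ff.
suff [g [gg /is_derive1_fun[df ->]]] :
  exists g, flat_algebra g /\ forall x, is_derive x 1 f (g x) by [].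
elim: ff => {f} [k c d|c f ff [f' [ff' df]]
  |f g ff [f' [ff' df]] gg [g' [gg' dg]]
  |f g ff [f' [ff' df]] gg [g' [gg' dg]]].
- exists (fun x =>
    c * (- k%:R * flat k.+1 (c * x + d) + flat k.+2 (c * x + d))).
  split; first by apply/flat_algebraZ/flat_algebraD; [apply/flat_algebraZ|];
    exact: flat_algebra_affine.
  move=> x; exact/is_derive_comp_affine/is_derive_flat.
- exists (fun x => c * f' x); split; first exact: flat_algebraZ.
  by move=> x; exact: (is_deriveZ c (df x)).
- exists (fun x => f' x + g' x); split; first exact: flat_algebraD.
  by move=> x; exact: (is_deriveD (df x) (dg x)).
- exists (fun x => f x * g' x + g x * f' x); split.
    by apply: flat_algebraD; exact: flat_algebraM.
  by move=> x; exact: (is_deriveM (df x) (dg x)).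
Qed.

Lemma smooth_derive1 f : smooth f -> smooth (derive1 f).
Proof. by move=> sf n x; rewrite -derive1Sn; exact: sf. Qed.

Lemma smooth_affine f c d : smooth f -> smooth (fun x => f (c * x + d)).
Proof.
move=> sf; pose S g := exists a h, smooth h /\ g = fun x => a * h (c * x + d).
have : S (fun x => f (c * x + d)).
  by exists 1, f; split => //; apply/funext => x; rewrite mul1r.
apply: smooth_class => _ [a [h [sh ->]]].
have [|? ->] := @is_derive1_fun (fun x => a * h (c * x + d))
  (fun x => (a * c) * derive1 h (c * x + d)).
  move=> x; rewrite -mulrA; apply: is_deriveZ; apply: is_derive_comp_affine.
  by rewrite derive1E; apply: derivableP; exact: (sh 0%N).
by split => //; exists (a * c), (derive1 h); split => //; exact: smooth_derive1.
Qed.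

Lemma smooth_continuous f : smooth f -> continuous f.
Proof.
move=> sf x; apply/differentiable_continuous/derivable1_diffP; exact: (sf 0%N).
Qed.

Lemma compact_closureP (A : set R) :
  compact (closure A) <-> exists M : R, forall x, A x -> `|x| <= M.
Proof.
split=> [/compact_bounded[M [_ MA]]|[M MA]].
  by exists (M + 1) => x Ax; apply: MA; [rewrite ltrDl|exact: subset_closure].
apply: (@subclosed_compact _ _ `[- M, M]) => //.
- exact: closed_closure.
- exact: segment_compact.
- rewrite closureE; apply: smallest_sub; first exact: interval_closed.
  by move=> x /MA; rewrite ler_norml /= in_itv.
Qed.

Lemma test_functionP psi :
  test_function psi <->
  smooth psi /\ exists M : R, forall x, psi x != 0 -> `|x| <= M.
Proof. by split=> -[? /compact_closureP]. Qed.

(** Where [psi] vanishes because the point is too far from the origin, it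
vanishes on a neighbourhood, hence so does its derivative. *)
Lemma test_function_derive1 psi :
  test_function psi -> test_function (derive1 psi).
Proof.
move=> /test_functionP[spsi [M psiM]]; apply/test_functionP; split.
  exact: smooth_derive1.
exists M => x; apply: contraNT; rewrite -ltNge => Mx.
have : is_derive x 1 psi 0.
  apply: (@near_eq_is_derive R R^o R^o (cst 0)).
  have nx : `|y| @[y --> x] --> `|x| by apply: cvg_norm.
  near=> y; apply/eqP; rewrite eq_sym.
  have : M < `|y| by near: y; exact: (cvgr_gt _ nx).
  by apply: contraTT => /psiM; rewrite -leNgt.
by rewrite derive1E => h; rewrite derive_val.
Unshelve. all: by end_near. Qed.

Lemma test_function_affine psi c d : c != 0 -> test_function psi ->
  test_function (fun x => psi (c * x + d)).
Proof.
move=> c0 /test_functionP[spsi [M psiM]]; apply/test_functionP; split.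
  exact: smooth_affine.
exists ((M + `|d|) / `|c|) => x /psiM h; rewrite ler_pdivlMr ?normr_gt0//.
rewrite -normrM mulrC (_ : c * x = (c * x + d) - d); last by rewrite addrK.
by rewrite (le_trans (ler_normB _ _))// lerD2r.
Qed.

Lemma derive1_affine f c d x : smooth f ->
  derive1 (fun x => f (c * x + d)) x = c * derive1 f (c * x + d).
Proof.
move=> sf; rewrite derive1E; apply: derive_val.
apply: is_derive_comp_affine; rewrite derive1E.
by apply: derivableP; exact: (sf 0%N).
Qed.

Lemma test_function_bounded psi : test_function psi ->
  exists B : R, forall x, `|psi x| <= B.
Proof.
move=> /test_functionP[spsi [M psiM]].
have cpsi := smooth_continuous spsi.
have : compact (psi @` `[-M, M]).
  apply: continuous_compact (@segment_compact _ _ _).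
  exact: continuous_subspaceT.
move=> /compact_bounded[B [_ HB]]; exists (Num.max 0 (B + 1)) => x.
have [->|/psiM] := eqVneq (psi x) 0; first by rewrite normr0 le_max lexx.
rewrite ler_norml => xM; rewrite le_max; apply/orP; right.
apply: (HB (B + 1)); first by rewrite ltrDl.
by exists x => //=; rewrite in_itv.
Qed.

(** A smooth bump on [`]c, d[], of the form
[exp (- ((x - c)^-1 + (d - x)^-1) / n.+1)], which increases to the indicator
as [n] grows. *)
Definition plateau n c d x : R :=
  flat 0 (n.+1%:R * (x - c)) * flat 0 (n.+1%:R * (d - x)).

Lemma flat0_itv x : 0 <= flat 0 x <= 1.
Proof.
rewrite /flat expr0 mul1r; case: ifPn => [x0|_]; last by rewrite lexx ler01.
by rewrite expR_ge0 expR_le1 oppr_le0 invr_ge0 ltW.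
Qed.

Lemma plateau_itv n c d x : 0 <= plateau n c d x <= 1.
Proof.
have /andP[a0 a1] := flat0_itv (n.+1%:R * (x - c)).
have /andP[b0 b1] := flat0_itv (n.+1%:R * (d - x)).
by rewrite mulr_ge0//= mulr_ile1.
Qed.

Lemma plateau_support n c d x : plateau n c d x != 0 -> c < x < d.
Proof.
rewrite /plateau /flat !pmulr_rgt0// !subr_gt0.
by case: (c < x); case: (x < d); rewrite ?mulr0 ?mul0r ?eqxx.
Qed.

Lemma test_function_plateau n c d : test_function (plateau n c d).
Proof.
apply/test_functionP; split.
  have -> : plateau n c d = fun x =>
      flat 0 (n.+1%:R * x + - (n.+1%:R * c)) *
      flat 0 (- n.+1%:R * x + n.+1%:R * d).
    apply/funext => x; rewrite /plateau; congr (flat _ _ * flat _ _); ring.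
  by apply/smooth_flat_algebra/flat_algebraM; exact: flat_algebra_affine.
exists (Num.max `|c| `|d|) => x /plateau_support /andP[cx xd].
rewrite le_max; apply/orP; have [x0|x0] := leP 0 x.
  by right; rewrite (ger0_norm x0) (le_trans (ltW xd)) ?ler_norm.
left; rewrite (ltr0_norm x0) (@le_trans _ _ (- c)) ?lerN2 ?(ltW cx)//.
by rewrite -normrN ler_norm.
Qed.

Lemma cvg_flat0 x : 0 < x -> flat 0 (n.+1%:R * x) @[n --> \oo] --> (1 : R).
Proof.
move=> x0.
rewrite (_ : (fun _ => _) = fun n => expR (- (x^-1 * harmonic n))); last first.
  apply/funext => n; rewrite /flat pmulr_rgt0// x0 expr0 mul1r invfM mulrC//.
rewrite -expR0; apply: continuous_cvg; first exact: continuous_expR.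
rewrite -oppr0 -(mulr0 x^-1); apply: cvgN; apply: cvgMr; exact: cvg_harmonic.
Qed.

Lemma cvg_plateau c d x : plateau n c d x @[n --> \oo] --> (\1_`]c, d[ x : R).
Proof.
rewrite indicE mem_setE in_itv/=.
have [/andP[cx xd]|cxd] := boolP (c < x < d).
  rewrite -[X in _ --> X]/(1 : R) -[1]mulr1.
  by apply: cvgM; apply: cvg_flat0; rewrite subr_gt0.
rewrite (_ : (fun _ => _) = cst 0); first exact: cvg_cst.
by apply/funext => n; apply/eqP; apply: contraNT cxd => /plateau_support.
Qed.

End SmoothFunctions.

(** * The fundamental lemma and uniqueness of weak derivatives *)

Section WeakDerivativeUniqueness.
Context {R : realType}.
Implicit Types (f g h psi : R -> R) (c d s t : R).
Notation mu := (@lebesgue_measure R).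

Lemma locally_integrableP f : locally_integrable [set: R] f <->
  measurable_fun [set: measurableTypeR R] f /\
  forall M, mu.-integrable `[- M, M] (EFin \o f).
Proof.
split=> [[mf _ fi]|[mf fi]]; split => //.
- move=> M; apply/integrableP; split.
    exact/measurable_EFinP/measurable_funTS.
  by apply: fi => //; exact: segment_compact.
- exact: openT.
- move=> K _ cK; have /compact_bounded[M [_ MK]] := cK.
  have /integrableP[_] := fi (M + 1); apply: le_lt_trans.
  apply: ge0_subset_integral => //=; first exact: compact_measurable.
    apply/measurable_EFinP; apply: measurableT_comp => //.
    exact: measurable_funTS.
  move=> x Kx /=; rewrite in_itv/= -ler_norml.
  by apply: MK => //; rewrite ltrDl.
Qed.

Lemma locally_integrable_itv h (b1 b2 : bool) s t :
  locally_integrable [set: R] h ->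
  mu.-integrable [set` Interval (BSide b1 s) (BSide b2 t)] (EFin \o h).
Proof.
move=> /locally_integrableP[_ hi].
apply: integrableS (hi (Num.max `|s| `|t|)) => //.
move=> x /= xst; rewrite in_itv/= -ler_norml.
have /andP[sx xt] : s <= x <= t.
  by move: xst; case: b1 b2 => -[]; rewrite in_itv/= => /andP[sx xt];
    apply/andP; split => //; exact: ltW.
rewrite le_max !ler_norml; apply/orP.
have [x0|x0] := leP 0 x.
  right; rewrite (le_trans _ x0) ?oppr_le0//= (le_trans xt)// ler_norm//.
left; rewrite (le_trans _ sx) ?lerNnormlW//= (le_trans (ltW x0))//.
Qed.

Lemma test_function_measurable psi : test_function psi ->
  measurable_fun [set: measurableTypeR R] psi.
Proof.
move=> /test_functionP[spsi _].
by apply: continuous_measurable_fun; exact: smooth_continuous.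
Qed.

(** The real-valued integral takes the value 0 on non-integrable functions, so
this is what makes the pairings in [is_weak_derivative] additive. *)
Lemma integrable_test f psi : locally_integrable [set: R] f ->
  test_function psi -> mu.-integrable [set: R] (fun x => (f x * psi x)%:E).
Proof.
move=> /locally_integrableP[mf fi] tpsi.
have [B HB] := test_function_bounded tpsi.
have [spsi [M psiM]] := (test_functionP psi).1 tpsi.
have mpsi := test_function_measurable tpsi.
have mI : measurable (`[- M, M]%classic : set (measurableTypeR R)) by [].
rewrite (_ : (fun _ => _) =
    (fun x : R => (f x * psi x)%:E) \_ `[- M, M]); last first.
  apply/funext => x; rewrite patchE; case: ifPn => // xM.
  have [->|/psiM] := eqVneq (psi x) 0; first by rewrite mulr0.
  by rewrite ler_norml => h; move: xM; rewrite mem_setE in_itv/= h.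
apply/(integrable_mkcond _ mI).
apply: le_integrable (integrableZl mI B (fi M)) => //.
  apply/measurable_EFinP; apply: measurable_funTS; exact: measurable_funM.
move=> x _ /=; rewrite lee_fin !normrM mulrC ler_wpM2r//.
by rewrite (le_trans (HB x))// ler_norm.
Qed.

Lemma cvg_integral_plateau h c d : locally_integrable [set: R] h ->
  (\int[mu]_x (h x * plateau n c d x)%:E @[n --> \oo] -->
    \int[mu]_(x in `]c, d[) (h x)%:E)%E.
Proof.
move=> lh; have /locally_integrableP[mh _] := lh.
have mD : measurable (`]c, d[%classic : set (measurableTypeR R)) by [].
have E n : (\int[mu]_x (h x * plateau n c d x)%:E =
    \int[mu]_(x in `]c, d[) (h x * plateau n c d x)%:E)%E.
  rewrite [RHS]integral_mkcond; apply: eq_integral => x _.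
  rewrite patchE; case: ifPn => //; rewrite mem_setE in_itv/= => cxd.
  have [->|/plateau_support] := eqVneq (plateau n c d x) 0.
    by rewrite mulr0.
  by rewrite (negbTE cxd).
under eq_cvg do rewrite E.
have mp n := test_function_measurable (test_function_plateau n c d).
have [] := @dominated_convergence _ _ _ mu _ mD
  (fun n x => (h x * plateau n c d x)%:E) (EFin \o h)
  (fun x => `|h x|%:E) => //.
- by move=> n; exact/measurable_funTS/measurable_EFinP/measurable_funM.
- exact/measurable_funTS/measurable_EFinP.
- apply: aeW => x; rewrite /= in_itv/= => cxd.
  apply: cvg_EFin; first exact: nearW.
  have := @cvg_plateau _ c d x; rewrite indicE mem_setE in_itv/= cxd => pl.
  by rewrite -[X in _ --> X]mulr1; exact: cvgMr pl.
- exact: integrable_abse (locally_integrable_itv _ _ _ _ lh).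
- apply: aeW => x n _; rewrite lee_fin normrM ler_piMr//.
  by have /andP[p0 p1] := plateau_itv n c d x; rewrite ger0_norm.
Qed.

(** Fundamental lemma of the calculus of variations: plateaus show that all
integrals of [h] over bounded intervals vanish, and the value of [h] at a
Lebesgue point is a limit of such integrals, suitably normalised. *)
Lemma ae_eq0_test h : locally_integrable [set: R] h ->
  (forall psi, test_function psi -> \int[mu]_x (h x * psi x) = 0) ->
  {ae mu, forall x, h x = 0}.
Proof.
move=> lh h0.
have i0 c d : (\int[mu]_(x in `]c, d[) (h x)%:E = 0)%E.
  have /(cvg_lim _) <- // := @cvg_integral_plateau h c d lh.
  rewrite (_ : (fun _ => _) = cst 0%E) ?lim_cst//.
  apply/funext => n /=; rewrite -[LHS]fineK.
    by congr EFin; apply: h0; exact: test_function_plateau.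
  apply: integrable_fin_num => //.
  exact/integrable_test/test_function_plateau.
pose E x n := `]x, (x + (n.+1%:R)^-1)[%classic : set R.
(* The interval is half of the ball of radius n.+1^-1, whence the factor 2. *)
have nE x : nicely_shrinking x (E x).
  split=> [n|]; first exact: measurable_itv.
  have r0 n : 0 < (n.+1%:R^-1 : R) by [].
  exists (2%R, fun n => PosNum (r0 n)); split => //=.
  - exact: cvg_harmonic.
  - move=> n z; rewrite /E /= in_itv/= /ball/= => /andP[xz zx].
    by rewrite distrC gtr0_norm ?subr_gt0// ltrBlDl.
  - move=> n.
    rewrite (lebesgue_measure_ball _ (ltW _))// lebesgue_measure_itv/=.
    by rewrite lte_fin ltrDl r0 -EFinD -EFinM lee_fin addrC addKr mulr_natl.
have := lebesgue_differentiation lh; apply: filterS => [|x hx].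
  exact: (ae_filter_ringOfSetsType mu).
have /(cvg_lim (@ereal_hausdorff R)) := nice_lebesgue_differentiation nE lh hx.
rewrite (_ : (fun _ => _) = cst 0%E) ?lim_cst//; first by case.
by apply/funext => n; rewrite i0 mule0.
Qed.

Lemma weak_derivative_unique f g1 g2 :
  is_weak_derivative f g1 -> is_weak_derivative f g2 ->
  {ae mu, forall x, g1 x = g2 x}.
Proof.
move=> [lf l1 w1] [_ l2 w2].
have : {ae mu, forall x, g1 x - g2 x = 0}.
  apply: (ae_eq0_test (h := g1 \- g2)); first exact: locally_integrableB.
  move=> psi tpsi; under eq_Rintegral do rewrite /= mulrBl.
  rewrite RintegralB//=; [|exact: integrable_test..].
  by apply/eqP; rewrite subr_eq0 -eqr_opp -w1// w2.
apply: filterS => [|x /eqP]; first exact: (ae_filter_ringOfSetsType mu).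
by rewrite subr_eq0 => /eqP.
Qed.

End WeakDerivativeUniqueness.

(** * Weak derivatives of dilations, translations and sums *)

Section WeakDerivativeOperations.
Context {R : realType}.
Implicit Types (f g h psi : R -> R) (a c d : R).
Notation mu := (@lebesgue_measure R).

Lemma locally_integrable_affine f c d : 0 < c ->
  locally_integrable [set: R] f ->
  locally_integrable [set: R] (fun x => f (c * x + d)).
Proof.
move=> c0 /locally_integrableP[mf fi]; apply/locally_integrableP; split.
  by apply: (measurableT_comp mf); exact: measurable_affine.
move=> M; pose M' := c * `|M| + `|d|.
have mM' : measurable (`[- M', M']%classic : set (measurableTypeR R)) by [].
apply/integrableP; split.
  apply/measurable_EFinP/measurable_funTS.
  by apply: (measurableT_comp mf); exact: measurable_affine.
have /integrableP[_ foo] := fi M'.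
have E := @ge0_integral_affine _ c d _ (fun x => `|(f x)%:E|%E) c0 mM'.
apply: (@le_lt_trans _ _
  (\int[mu]_(x in affine c d @^-1` `[(- M')%R, M']) `|(f (c * x + d))%:E|)%E).
  apply: ge0_subset_integral => //.
  - rewrite affine_preimage_itv//; exact: measurable_itv.
  - do 2 apply: measurableT_comp => //; apply/measurable_funTS.
    by apply: (measurableT_comp mf); exact: measurable_affine.
  - move=> x; rewrite /= !in_itv/= -!ler_norml => xM.
    rewrite (le_trans (ler_normD _ _))// lerD2r.
    rewrite normrM (gtr0_norm c0) ler_pM2l//.
    by rewrite (le_trans xM)// ler_norm.
rewrite E//; last first.
  by apply: measurableT_comp => //; exact/measurable_EFinP/measurable_funTS.
by apply: lte_mul_pinfty => //; rewrite lee_fin invr_ge0 ltW.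
Qed.

Lemma locally_integrableZ a f : locally_integrable [set: R] f ->
  locally_integrable [set: R] (fun x => a * f x).
Proof.
move=> /locally_integrableP[mf fi]; apply/locally_integrableP; split.
  exact: measurable_funM.
move=> M.
have mI : measurable (`[- M, M]%classic : set (measurableTypeR R)) by [].
exact: (integrableZl mI a (fi M)).
Qed.

(** Test against [chi(y) = psi((y - d) / c)] instead of [psi] and substitute
[y = c x + d]: the chain rule for [chi] contributes the factor [c]. *)
Lemma is_weak_derivative_affine f g c d : 0 < c -> is_weak_derivative f g ->
  is_weak_derivative (fun x => f (c * x + d)) (fun x => c * g (c * x + d)).
Proof.
move=> c0 [lf lg fg]; have cn0 : c != 0 by rewrite gt_eqF.
have lfa := locally_integrable_affine d c0 lf.
have lga := locally_integrable_affine d c0 lg.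
split => //; first exact: locally_integrableZ.
move=> psi tpsi; have [spsi _] := tpsi.
pose chi x := psi (c^-1 * x + - (d / c)).
have tchi : test_function chi by apply: test_function_affine; rewrite ?invr_eq0.
have tchi' := test_function_derive1 tchi.
have affK x : c^-1 * (c * x + d) + - (d / c) = x by field.
have chiE x : chi (c * x + d) = psi x by rewrite /chi affK.
have chi'E x : derive1 chi (c * x + d) = c^-1 * derive1 psi x.
  by rewrite /chi derive1_affine// affK.
have := Rintegral_affine d c0 (integrable_test lf tchi').
have := Rintegral_affine d c0 (integrable_test lg tchi).
have := fg chi tchi.
under [X in _ -> X = _ -> _]eq_Rintegral do rewrite chiE.
under [X in _ -> _ -> X = _ -> _]eq_Rintegral do rewrite chi'E mulrCA.
have ig := integrable_test lga tpsi.
have if' := integrable_test lfa (test_function_derive1 tpsi).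
rewrite RintegralZl// => e1 e2 /(mulfI (invr_neq0 cn0)) ->.
under [in RHS]eq_Rintegral do rewrite -mulrA.
by rewrite RintegralZl// e2 e1 mulrA mulfV// mul1r.
Qed.

Lemma is_weak_derivativeZ a f g : is_weak_derivative f g ->
  is_weak_derivative (fun x => a * f x) (fun x => a * g x).
Proof.
move=> [lf lg fg]; split; [exact: locally_integrableZ..|] => psi tpsi.
under eq_Rintegral do rewrite -mulrA.
under [in RHS]eq_Rintegral do rewrite -mulrA.
rewrite !RintegralZl ?fg ?mulrN//; first exact: integrable_test.
by apply: integrable_test => //; exact: test_function_derive1.
Qed.

Lemma is_weak_derivative0 : is_weak_derivative (fun=> 0 : R) (fun=> 0 : R).
Proof.
have l0 : locally_integrable [set: R] (fun=> 0 : R).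
  by apply/locally_integrableP; split => // M; exact: integrable0.
split => // psi _; under eq_Rintegral do rewrite mul0r.
under [in RHS]eq_Rintegral do rewrite mul0r.
by rewrite Rintegral_cst// mul0r oppr0.
Qed.

Lemma is_weak_derivativeD f1 g1 f2 g2 :
  is_weak_derivative f1 g1 -> is_weak_derivative f2 g2 ->
  is_weak_derivative (fun x => f1 x + f2 x) (fun x => g1 x + g2 x).
Proof.
move=> [lf1 lg1 fg1] [lf2 lg2 fg2]; split; [exact: locally_integrableD..|].
move=> psi tpsi.
have tpsi' := test_function_derive1 tpsi.
under eq_Rintegral do rewrite mulrDl.
under [in RHS]eq_Rintegral do rewrite mulrDl.
by rewrite !RintegralD ?fg1 ?fg2 ?opprD//; exact: integrable_test.
Qed.

Lemma is_weak_derivative_sum (F G : nat -> R -> R) n :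
  (forall i, is_weak_derivative (F i) (G i)) ->
  is_weak_derivative (fun x => \sum_(0 <= i < n) F i x)
                     (fun x => \sum_(0 <= i < n) G i x).
Proof.
move=> FG; elim: n => [|n IHn].
  under eq_fun do rewrite big_nil.
  under [X in is_weak_derivative _ X]eq_fun do rewrite big_nil.
  exact: is_weak_derivative0.
under eq_fun do rewrite big_nat_recr//=.
under [X in is_weak_derivative _ X]eq_fun do rewrite big_nat_recr//=.
exact: is_weak_derivativeD.
Qed.

Lemma is_weak_derivative_W a b phi dphi N : 0 < b ->
  is_weak_derivative phi dphi ->
  is_weak_derivative (W a b phi N) (dW a b dphi N).
Proof.
move=> b0 pd; apply: is_weak_derivative_sum => n.
have := is_weak_derivativeZ (a ^+ n)
  (is_weak_derivative_affine 0 (exprn_gt0 n b0) pd).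
congr is_weak_derivative; apply/funext => x; first by rewrite addr0.
by rewrite addr0 mulrA -exprMn.
Qed.

End WeakDerivativeOperations.

(** * Local square integrability and the norm of L^2(0,1) *)

Section SquareIntegrability.
Context {R : realType}.
Implicit Types (f g h : R -> R) (a c d : R).
Notation mu := (@lebesgue_measure R).

Lemma measurable_sqnorm f : measurable_fun [set: measurableTypeR R] f ->
  measurable_fun [set: measurableTypeR R] (fun x => `|f x| ^+ 2).
Proof. by move=> mf; apply: measurable_funX; exact: measurableT_comp. Qed.

Lemma measurable_sqnorm_EFin (D : set R) f :
  measurable_fun [set: measurableTypeR R] f ->
  @measurable_fun _ _ (measurableTypeR R) _ D (fun x => (`|f x| ^+ 2)%:E).
Proof.
move=> mf; apply/measurable_EFinP; apply: measurable_funTS.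
exact: measurable_sqnorm.
Qed.

Lemma L2_locP f : L2_loc f <->
  measurable_fun [set: measurableTypeR R] f /\
  locally_integrable [set: R] (fun x => `|f x| ^+ 2).
Proof.
split=> [[mf fi]|[mf [_ _ fi]]]; split => //.
- split => [||K _ cK]; [exact: measurable_sqnorm|exact: openT|].
  under eq_integral do rewrite ger0_norm ?sqr_ge0//.
  exact: fi.
- move=> K cK; have := fi K (@subsetT _ _) cK.
  by under eq_integral do rewrite ger0_norm ?sqr_ge0//.
Qed.

Lemma locally_integrable_le f g : measurable_fun [set: measurableTypeR R] f ->
  (forall x, `|f x| <= g x) -> locally_integrable [set: R] g ->
  locally_integrable [set: R] f.
Proof.
move=> mf fg /locally_integrableP[mg gi].
apply/locally_integrableP; split => // M.
have mI : measurable (`[- M, M]%classic : set (measurableTypeR R)) by [].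
apply: le_integrable (gi M) => //.
  exact/measurable_EFinP/measurable_funTS.
by move=> x _; rewrite lee_fin (le_trans (fg x))// ler_norm.
Qed.

Lemma L2_locZ a f : L2_loc f -> L2_loc (fun x => a * f x).
Proof.
move=> /L2_locP[mf fi]; apply/L2_locP; split; first exact: measurable_funM.
under eq_fun do rewrite normrM exprMn.
exact: locally_integrableZ.
Qed.

(** Uses [(u + v)^2 <= 2 (u^2 + v^2)]. *)
Lemma L2_locD f g : L2_loc f -> L2_loc g -> L2_loc (fun x => f x + g x).
Proof.
move=> /L2_locP[mf fi] /L2_locP[mg gi]; apply/L2_locP.
have mfg : measurable_fun [set: measurableTypeR R] (fun x => f x + g x).
  exact: measurable_funD.
split => //; have := locally_integrableZ 2 (locally_integrableD fi gi).
apply: locally_integrable_le => [|x]; first exact: measurable_sqnorm.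
rewrite ger0_norm ?sqr_ge0//= -!normrX !ger0_norm ?sqr_ge0//.
by have := sqr_ge0 (f x - g x); nra.
Qed.

Lemma L2_loc_affine f c d : 0 < c -> L2_loc f ->
  L2_loc (fun x => f (c * x + d)).
Proof.
move=> c0 /L2_locP[mf fi]; apply/L2_locP; split.
  by apply: (measurableT_comp mf); exact: measurable_affine.
exact: locally_integrable_affine c0 fi.
Qed.

Lemma L2_loc_ae f g : measurable_fun [set: measurableTypeR R] f ->
  {ae mu, forall x, f x = g x} -> L2_loc g -> L2_loc f.
Proof.
move=> mf fg Lg; have [mg _] := (L2_locP g).1 Lg; have [_ gi] := Lg.
split => // K cK.
rewrite (@ae_eq_integral _ _ _ mu _ (fun x => (`|g x| ^+ 2)%:E)) //.
- exact: gi.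
- exact: compact_measurable.
- exact: measurable_sqnorm_EFin.
- exact: measurable_sqnorm_EFin.
- apply: filterS fg => [|x ->//]; exact: (ae_filter_ringOfSetsType mu).
Qed.

Lemma L2_loc_dW a b dphi N : 0 < b -> L2_loc dphi -> L2_loc (dW a b dphi N).
Proof.
move=> b0 Ld; rewrite /dW; elim: N.+1 => {N} [|N IHN].
  under eq_fun do rewrite big_nil.
  have := L2_locZ 0 Ld; congr L2_loc; apply/funext => x.
  by rewrite mul0r.
under eq_fun do rewrite big_nat_recr//=; apply: L2_locD => //; apply: L2_locZ.
have := L2_loc_affine 0 (exprn_gt0 N b0) Ld.
by under eq_fun do rewrite addr0.
Qed.

(** Points are null sets, so the open interval of [on_unit] can be closed, which
is the form in which affine substitution and periodicity are applied. *)
Lemma L2_loc_unit f : L2_loc f ->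
  'N[mu]_2%:E[EFin \o on_unit f]%E =
    ((\int[mu]_(x in `[0%R, 1%R]) (`|f x| ^+ 2)%:E) `^ (2^-1))%E.
Proof.
move=> /L2_locP[mf _]; rewrite unlock; congr (_ `^ _)%E.
transitivity (\int[mu]_(x in `]0%R, 1%R[) (`|f x| ^+ 2)%:E)%E.
  rewrite [RHS]integral_mkcond; apply: eq_integral => x _.
  rewrite /= /on_unit !patchE; case: ifPn => _.
    by rewrite powR_mulrn.
  by rewrite normr0 powR0// pnatr_eq0.
rewrite integral_itv_bndo_bndc; last exact: measurable_sqnorm_EFin.
by rewrite integral_itv_obnd_cbnd//; exact: measurable_sqnorm_EFin.
Qed.

Lemma L2normE f : L2_loc f ->
  L2norm f = Num.sqrt (\int[mu]_(x in `[0, 1]) (`|f x| ^+ 2)).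
Proof.
move=> Lf; rewrite /L2norm L2_loc_unit// fine_poweR powR12_sqrt//.
by apply: fine_ge0; apply: integral_ge0 => x _; rewrite lee_fin sqr_ge0.
Qed.

Lemma L2normZ c f : 0 <= c -> L2_loc f ->
  L2norm (fun x => c * f x) = c * L2norm f.
Proof.
move=> c0 Lf; rewrite !L2normE//; last exact: L2_locZ.
under eq_Rintegral do rewrite normrM exprMn (ger0_norm c0).
rewrite RintegralZl//; first by rewrite sqrtrM ?sqr_ge0// sqrtr_sqr ger0_norm.
have [_ lf] := (L2_locP _).1 Lf.
exact: locally_integrable_itv.
Qed.

Lemma L2_unit_L2_loc f : L2_loc f -> L2_unit f.
Proof.
move=> Lf; have [mf fi] := Lf; rewrite /L2_unit inE/= /finite_norm.
apply/andP; split; rewrite inE/=.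
  by apply/(measurable_restrictT _ _).1 => //; exact: measurable_funTS.
rewrite /finite_norm L2_loc_unit//; apply: poweR_lty; apply: fi.
exact: segment_compact.
Qed.

End SquareIntegrability.

(** * Means of nonnegative periodic functions over long intervals *)

Section PeriodicMean.
Context {R : realType}.
Implicit Types (f g h : R -> R) (a c d s t : R).
Notation mu := (@lebesgue_measure R).

Variable h : R -> R.
Hypothesis lh : locally_integrable [set: R] h.
Hypothesis h_ge0 : forall x, 0 <= h x.
Hypothesis h_per : {ae mu, forall x, h (x + 1) = h x}.

Let mh : measurable_fun [set: measurableTypeR R] h.
Proof. by have /locally_integrableP[] := lh. Qed.

Notation I t := (\int[mu]_(x in `[0, t]) h x).

Lemma Rintegral_itv_ge0 (D : set R) : 0 <= \int[mu]_(x in D) h x.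
Proof. exact: Rintegral_ge0. Qed.

Lemma Rintegral_itvS s t : 0 <= s -> s <= t ->
  I t = I s + \int[mu]_(x in `]s, t]) h x.
Proof.
move=> s0 st; rewrite -(@Rintegral_itvB _ h (BLeft 0) (BRight t) s) ?bnd_simp//.
  by rewrite addrC subrK.
exact: locally_integrable_itv.
Qed.

Lemma le_Rintegral_itv s t : 0 <= s -> s <= t -> I s <= I t.
Proof.
by move=> s0 st; rewrite (Rintegral_itvS s0 st) lerDl Rintegral_itv_ge0.
Qed.

(** Half-open intervals tile the half-line without overlap.  Periodicity holds
only almost everywhere, so consecutive periods are compared as integrals, one
translation at a time. *)
Lemma Rintegral_itv_periodic n :
  \int[mu]_(x in `]n%:R, n.+1%:R]) h x = \int[mu]_(x in `]0, 1]) h x.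
Proof.
elim: n => [//|n <-]; congr fine.
pose D := `]n.+1%:R, n.+2%:R]%classic : set (measurableTypeR R).
have mD : measurable D by exact: measurable_itv.
have mhD : measurable_fun D (EFin \o h).
  by apply: measurable_funTS; exact/measurable_EFinP.
have h0 x : D x -> (0 <= (h x)%:E)%E by rewrite lee_fin.
have := @ge0_integral_affine R 1 1 _ (EFin \o h) ltr01 mD mhD h0.
rewrite /D affine_preimage_itv// invr1 mul1e !mulr1.
have -> : n.+1%:R - 1 = n%:R :> R by rewrite -natr1 addrK.
have -> : n.+2%:R - 1 = n.+1%:R :> R by rewrite -natr1 addrK.
move=> <-.
apply: ae_eq_integral => //.
- apply: measurable_funTS; apply/measurable_EFinP.
  by apply: (measurableT_comp mh); exact: measurable_affine.
- by apply: measurable_funTS; exact/measurable_EFinP.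
- apply: filterS h_per => [|x /=]; first exact: (ae_filter_ringOfSetsType mu).
  by rewrite mul1r => ->.
Qed.

Lemma Rintegral_itv_nat n : I n%:R = n%:R * I 1.
Proof.
have I0 : I 0 = 0 by rewrite set_itv1 Rintegral_set1.
elim: n => [|n IHn]; first by rewrite I0 mul0r.
rewrite (@Rintegral_itvS n%:R) ?ler_nat// IHn Rintegral_itv_periodic.
by rewrite (@Rintegral_itvS 0 1)// I0 add0r -natr1 mulrDl mul1r.
Qed.

(** With [n <= t < n + 1], both [I t] and [t * I 1] lie between [n * I 1] and
[(n + 1) * I 1]: the first by monotonicity, as [h] is nonnegative. *)
Lemma Rintegral_itv_mean t : 0 <= t -> `|I t - t * I 1| <= I 1.
Proof.
move=> t0; have /andP[nt tn] := truncn_itv t0.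
have := le_Rintegral_itv (ler0n _ _) nt.
have := le_Rintegral_itv t0 (ltW tn).
have : 0 <= I 1 := Rintegral_itv_ge0 _.
rewrite !Rintegral_itv_nat -natr1; move: nt tn; rewrite -natr1.
move: (I t) (I 1) (Num.truncn t)%:R => J J1 n nt tn J1_ge0 u l.
have p1 : 0 <= J1 * (t - n) by rewrite mulr_ge0// subr_ge0.
have p2 : 0 <= J1 * (n + 1 - t) by rewrite mulr_ge0// subr_ge0 ltW.
by rewrite ler_norml; apply/andP; split; lra.
Qed.

Lemma cvg_mean_exp b : 1 < b ->
  (b ^+ N)^-1 * I (b ^+ N) @[N --> \oo] --> I 1.
Proof.
move=> b1; have b0 : 0 < b by rewrite (lt_trans _ b1).
have bi : b^-1 ^+ N @[N --> \oo] --> (0 : R).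
  by apply: cvg_expr; rewrite gtr0_norm ?invr_gt0// invf_lt1.
have {}bi : I 1 * b^-1 ^+ N @[N --> \oo] --> I 1 * 0 by exact: cvgMr.
rewrite mulr0 in bi.
apply/subr_cvg0/norm_cvg0P; apply: squeeze_cvgr (cvg_cst 0) bi.
near=> N; have bN : 0 < b ^+ N by rewrite exprn_gt0.
rewrite normr_ge0/= exprVn ler_pdivlMr// -[X in _ * X](gtr0_norm bN) -normrM.
rewrite mulrBl mulrAC mulVf ?gt_eqF// mul1r [X in _ - X]mulrC.
by rewrite Rintegral_itv_mean// ltW.
Unshelve. all: by end_near. Qed.

End PeriodicMean.

(** * Increments of the derivatives of Weierstrass-type sums *)

Section Increments.
Context {R : realType}.
Variables (phi dphi : R -> R) (a b : R).
Notation mu := (@lebesgue_measure R).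
Hypotheses (phi_H1 : H1_per phi) (dphi_weak : is_weak_derivative phi dphi).
Hypothesis b_gt1 : 1 < b.

Let b_gt0 : 0 < b. Proof. exact: lt_trans b_gt1. Qed.

(** [phi] has some locally square integrable weak derivative, and [dphi] agrees
with it almost everywhere. *)
Lemma L2_loc_weak_derivative : L2_loc dphi.
Proof.
have [_ [_ [g [phi_g Lg]]]] := phi_H1.
apply: L2_loc_ae Lg; last exact: weak_derivative_unique phi_g.
by have [_ /locally_integrableP[]] := dphi_weak.
Qed.

(** [phi] equals its translate by 1, so the translate of [dphi] is another weak
derivative of [phi]. *)
Lemma weak_derivative_periodic : {ae mu, forall x, dphi (x + 1) = dphi x}.
Proof.
have [phi1 _] := phi_H1.
have := weak_derivative_unique (is_weak_derivative_affine 1 ltr01 dphi_weak).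
rewrite (_ : (fun x => phi (1 * x + 1)) = phi); last first.
  by apply/funext => x; rewrite mul1r phi1.
move=> /(_ _ dphi_weak); apply: filterS => [|x].
  exact: (ae_filter_ringOfSetsType mu).
by rewrite !mul1r.
Qed.

Notation h := (fun x => `|dphi x| ^+ 2).

Let lh : locally_integrable [set: R] h.
Proof. by have [] := (L2_locP _).1 L2_loc_weak_derivative. Qed.

Let h_ge0 x : 0 <= h x. Proof. exact: sqr_ge0. Qed.

Let h_per : {ae mu, forall x, h (x + 1) = h x}.
Proof.
apply: filterS weak_derivative_periodic => [|x /= -> //].
exact: (ae_filter_ringOfSetsType mu).
Qed.

Lemma zeta_cvg : zeta b dphi N @[N --> \oo] --> L2norm dphi.
Proof.
rewrite (L2normE L2_loc_weak_derivative).
apply: (@continuous_cvg _ _ _ _ _ _ Num.sqrt); first exact: sqrt_continuous.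
exact: cvg_mean_exp.
Qed.

Lemma zeta_nat k N : b = k%:R -> zeta b dphi N = L2norm dphi.
Proof.
move=> bk; rewrite (L2normE L2_loc_weak_derivative) /zeta.
have bN : b ^+ N = (k ^ N)%:R by rewrite bk natrX.
have bN0 : b ^+ N != 0 by rewrite gt_eqF ?exprn_gt0.
by rewrite {2}bN Rintegral_itv_nat// -bN mulKf.
Qed.

Lemma dW_increment N : (1 <= N)%N ->
  dW a b dphi N \- dW a b dphi N.-1 = fun x => (a * b) ^+ N * dphi (b ^+ N * x).
Proof.
case: N => // N _; apply/funext => x; rewrite /dW/= big_nat_recr//=.
by rewrite [X in X - _]addrC addrK.
Qed.

Lemma L2norm_dilation N :
  L2norm (fun x => dphi (b ^+ N * x)) = zeta b dphi N.
Proof.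
have bN : 0 < b ^+ N by rewrite exprn_gt0.
have Lb : L2_loc (fun x => dphi (b ^+ N * x)).
  have := L2_loc_affine 0 bN L2_loc_weak_derivative.
  by under eq_fun do rewrite addr0.
rewrite L2normE// /zeta; congr Num.sqrt.
have mD : measurable (`[0, b ^+ N]%classic : set (measurableTypeR R)) by [].
have [mdphi _] := (L2_locP _).1 L2_loc_weak_derivative.
have h0 x : `[0, b ^+ N]%classic x -> (0 <= (h x)%:E)%E by rewrite lee_fin.
have := ge0_integral_affine 0 bN mD (measurable_sqnorm_EFin mdphi) h0.
rewrite affine_preimage_itv// subr0 mul0r subr0 mulfV ?gt_eqF//.
under eq_integral do rewrite addr0.
rewrite /Rintegral => ->; rewrite fineM//.
apply: integrable_fin_num => //; exact: locally_integrable_itv.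
Qed.

Hypothesis ab_gt1 : 1 < a * b.
Let ab_gt0 : 0 < a * b. Proof. exact: lt_trans ab_gt1. Qed.

Lemma L2norm_increment N : (1 <= N)%N ->
  L2norm (dW a b dphi N \- dW a b dphi N.-1) = (a * b) ^+ N * zeta b dphi N.
Proof.
move=> N1; rewrite dW_increment// -L2norm_dilation L2normZ//.
  by rewrite exprn_ge0// ltW.
have := L2_loc_affine 0 (exprn_gt0 N b_gt0) L2_loc_weak_derivative.
by under eq_fun do rewrite addr0.
Qed.

Hypothesis dphi_gt0 : 0 < L2norm dphi.

(** The quotient is [zeta_N / ||dphi||] from rank 1 on. *)
Lemma increment_asymp : asymp_equiv
  (fun N => L2norm (dW a b dphi N \- dW a b dphi N.-1))
  (fun N => (a * b) ^+ N * L2norm dphi).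
Proof.
have : zeta b dphi N / L2norm dphi @[N --> \oo] --> (1 : R).
  rewrite -(mulfV (lt0r_neq0 dphi_gt0)).
  by apply: cvgM; [exact: zeta_cvg|exact: cvg_cst].
apply: cvg_trans; apply: near_eq_cvg; near=> N.
rewrite L2norm_increment; last by near: N; exists 1%N.
by rewrite -mulf_div mulfV ?mul1r// gt_eqF// exprn_gt0.
Unshelve. all: by end_near. Qed.

(** Eventually [zeta_N >= ||dphi|| / 2 > 0], while [(a b)^N] is unbounded. *)
Lemma increment_diverge :
  L2norm (dW a b dphi N \- dW a b dphi N.-1) @[N --> \oo] --> +oo.
Proof.
have abN : (a * b) ^+ N @[N --> \oo] --> +oo.
  apply/gtr0_cvgV0; first by apply: nearW => N; rewrite exprn_gt0.
  under eq_cvg do rewrite /= -exprVn.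
  by apply: cvg_expr; rewrite gtr0_norm ?invr_gt0// invf_lt1.
have L2 : 0 < L2norm dphi / 2 by rewrite divr_gt0.
apply/cvgryPge => A; near=> N.
rewrite L2norm_increment; last by near: N; exists 1%N.
have : A / (L2norm dphi / 2) <= (a * b) ^+ N.
  by near: N; have /cvgryPge := abN; exact.
rewrite ler_pdivrMr// => /le_trans; apply; rewrite ler_pM2l ?exprn_gt0//.
near: N; apply: cvgr_ge zeta_cvg _ _.
by rewrite ltr_pdivrMr// ltr_pMr// ltr1n.
Unshelve. all: by end_near. Qed.

Lemma dW_not_cauchy : ~ L2_cauchy (dW a b dphi).
Proof.
move=> /(_ 1 ltr01)[M HM].
have /cvgryPge/(_ 1) := increment_diverge.
have : \forall N \near \oo, (M.+1 <= N)%N by exists M.+1.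
move=> /filterI /[apply] => /filter_ex[N [MN]].
rewrite leNgt HM//; first exact: ltnW.
by rewrite -ltnS prednK// (leq_ltn_trans _ MN).
Qed.

End Increments.

Theorem theorem2p3 (R : realType) (phi dphi : R -> R) (a b : R)
  (phi_H1 : H1_per phi)
  (dphi_weak : is_weak_derivative phi dphi)
  (dphi_gt0 : 0 < L2norm dphi)
  (b_gt1 : 1 < b) (a_gt0 : 0 < a) (a_lt1 : a < 1) (ab_gt1 : 1 < a * b) :
  (forall N : nat,
      is_weak_derivative (W a b phi N) (dW a b dphi N) /\
      L2_unit (dW a b dphi N)) /\
  (forall N : nat, (1 <= N)%N ->
      L2norm (dW a b dphi N \- dW a b dphi N.-1) =
      (a * b) ^+ N * zeta b dphi N) /\
  (zeta b dphi N @[N --> \oo] --> L2norm dphi) /\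
  asymp_equiv (fun N => L2norm (dW a b dphi N \- dW a b dphi N.-1))
              (fun N => (a * b) ^+ N * L2norm dphi) /\
  (L2norm (dW a b dphi N \- dW a b dphi N.-1) @[N --> \oo] --> +oo) /\
  ~ L2_cauchy (dW a b dphi) /\
  (forall k : nat, (2 <= k)%N -> b = k%:R ->
      forall N : nat, zeta b dphi N = L2norm dphi).
Proof.
have b_gt0 : 0 < b := lt_trans ltr01 b_gt1.
split=> [N|]; first split.
- exact: is_weak_derivative_W.
- apply/L2_unit_L2_loc/L2_loc_dW => //.
  exact: L2_loc_weak_derivative phi_H1 dphi_weak.
split; first by move=> N; exact: (L2norm_increment phi_H1 dphi_weak).
split; first exact: (zeta_cvg phi_H1 dphi_weak).
split; first exact: (increment_asymp phi_H1 dphi_weak).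
split; first exact: (increment_diverge phi_H1 dphi_weak).
split; first exact: (dW_not_cauchy phi_H1 dphi_weak).
by move=> k _ bk N; exact: (zeta_nat phi_H1 dphi_weak b_gt1 N bk).
Qed.
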